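(* Let $p^*\in H^1_0(\Omega)$ be fixed and let $C_{p^*}$ be such that $\|\alpha_s(x,p^* )\nabla p^*\|_\infty\le C_{p^*}$. If $H$ is sufficiently small such that $C_IC_{p^*}H<1$, where $C_I$ is the constant from the interpolation estimates for $I_H$, then the bilinear form defined by the Fréchet derivative linearization, $$\mathcal{A}_L(p^*,v,w)=\int_\Omega\bigl(\alpha(x,p^* )\nabla v+v\,\alpha_s(x,p^* )\nabla p^*\bigr)\cdot\nabla w\,dx,$$ is coercive on $W=\ker I_H$, i.e. there is a constant $c>0$ such that $\mathcal{A}_L(p^*,w,w)\ge c\,|w|_1^2$ for all $w\in W$.
   Context: $\Omega\subset\mathbb{R}^d$, $d\le3$, is an open bounded domain; $\|\cdot\|_0$ is the $L^2(\Omega)$-norm, $|\cdot|_1$ the $H^1(\Omega)$-seminorm, $\|\cdot\|_\infty$ the $L^\infty(\Omega)$-norm; an extra subscript denotes restriction to a subdomain. The coefficient $\alpha(x,s)\in\mathbb{R}^{d\times d}$ is $L^\infty$ in $x\in\Omega$, twice differentiable in $s\in\mathbb{R}$ (with $\alpha_s$ the derivative in $s$), and satisfies, with constants $\Lambda_0,\Lambda_1,\lambda>0$: $|\alpha(x,s_1)-\alpha(x,s_2)|\le\Lambda_0|s_1-s_2|$; $\alpha(x,s)\psi\cdot\psi\ge\lambda|\psi|^2$; $|\alpha(x,s)\psi|\le\Lambda_1|\psi|$ for all $x\in\Omega$, $s,s_1,s_2\in\mathbb{R}$, $\psi\in\mathbb{R}^d$. $\mathcal{T}_H$ is a shape-regular,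 quasi-uniform partition of $\Omega$ into simplices or quadrilaterals with maximal diameter $H$; $V_H\subset H^1_0(\Omega)$ is the lowest-order conforming finite element space on $\mathcal{T}_H$. $I_H:H^1_0(\Omega)\to V_H$ is a bounded local linear projection ($I_Hv_H=v_H$ for $v_H\in V_H$) with the stability and approximation properties $|I_Hv|_{1,K}\lesssim|v|_{1,N(K)}$ and $\|v-I_Hv\|_{0,K}\lesssim H|v|_{1,N(K)}$ for all $v\in H^1_0(\Omega)$, $K\in\mathcal{T}_H$, where $N(K)$ is the union of elements having nonempty intersection with $K$. Here $a\lesssim b$ means $a\le Cb$ with a generic constant $C$ independent of the discretization and multiscale parameters, and $C_I$ is the constant from these interpolation estimates.
   Formalization: The smallness condition is taken as C_I C_{p*} H < λ, with λ the ellipticity constant (the printed condition fails for small λ), and C_I is the local interpolation constant times the square root of the maximal overlap of the patches N(K). *)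

(* Defs.v *)
From HB Require Import structures.
From mathcomp Require Import all_boot all_order all_algebra.
From mathcomp Require Import all_classical all_reals all_analysis.
Set Implicit Arguments. Unset Strict Implicit. Unset Printing Implicit Defensive.
Import Order.TTheory GRing.Theory Num.Theory numFieldNormedType.Exports.
Local Open Scope classical_set_scope.
Local Open Scope ring_scope.

Definition mx_display : measure_display -> measure_display.
Proof. exact. Qed.

(* sigma-algebra generated by the entries; on R-valued matrices this is the
   Borel sigma-algebra of the (second countable) topology *)
Section measurable_matrix.
Context {disp} {T : sigmaRingType disp} (m n : nat).

Definition mx_entries_sigma : set (set 'M[T]_(m, n)) :=
  <<s \bigcup_(ij in [set: 'I_m * 'I_n])
        preimage_set_system setT (fun M : 'M[T]_(m, n) => M ij.1 ij.2) measurable >>.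

Let mx0 : mx_entries_sigma set0.
Proof. exact: sigma_algebra0. Qed.

Let mxC A : mx_entries_sigma A -> mx_entries_sigma (~` A).
Proof. exact: sigma_algebraC. Qed.

Let mxU (F : _^nat) : (forall i, mx_entries_sigma (F i)) ->
  mx_entries_sigma (\bigcup_i (F i)).
Proof. exact: sigma_algebra_bigcup. Qed.

HB.instance Definition _ := @isMeasurable.Build (mx_display disp)
  'M[T]_(m, n) mx_entries_sigma mx0 mxC mxU.

End measurable_matrix.

Section measurable_matrix_lemmas.
Context disp (T : measurableType disp).

Lemma measurable_entry m n i j :
  measurable_fun [set: 'M[T]_(m, n)] (fun M => M i j).
Proof.
by move=> _ Y mY; apply: sub_sigma_algebra; exists (i, j) => //; exists Y.
Qed.

Lemma measurable_fun_mx disp' (U : measurableType disp') m n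
    (f : U -> 'M[T]_(m, n)) :
  (forall i j, measurable_fun [set: U] (fun x => f x i j)) ->
  measurable_fun [set: U] f.
Proof.
move=> mf _ Y mY; apply: (mY (image_set_system setT f measurable)).
split.
  apply: (@sigma_algebra_image _ _ setT f); exact: sigma_algebra_measurable.
by move=> A [ij _ [B mB <-]]; rewrite /image_set_system /= setTI; exact: mf.
Qed.

End measurable_matrix_lemmas.

(* Lebesgue measure on R^n, by iterated products along R^(n+1) = R x R^n *)
Section lebesgue_vector.
Variable R : realType.

Definition vcons n (p : R * 'cV[R]_n) : 'cV[R]_n.+1 :=
  \col_i if unlift ord0 i is Some k then p.2 k ord0 else p.1.

Definition vuncons n (v : 'cV[R]_n.+1) : R * 'cV[R]_n :=
  (v ord0 ord0, \col_k v (lift ord0 k) ord0).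

Lemma vconsK n : cancel (@vcons n) (@vuncons n).
Proof.
case=> a v; rewrite /vuncons !mxE unlift_none; congr pair.
by apply/colP => k; rewrite !mxE liftK.
Qed.

Lemma measurable_vcons n : measurable_fun setT (@vcons n).
Proof.
apply: measurable_fun_mx => i j.
have [k ->|->] := unliftP ord0 i.
  rewrite (_ : (fun _ => _) = (fun v : 'cV[R]_n => v k ord0) \o snd).
    by apply: measurableT_comp => //; exact: measurable_entry.
  by apply/funext => p; rewrite mxE liftK.
rewrite (_ : (fun _ => _) = fst) //.
by apply/funext => p; rewrite mxE unlift_none.
Qed.

Lemma measurable_vuncons n : measurable_fun setT (@vuncons n).
Proof.
apply: measurable_fun_pair; first exact: measurable_entry.
apply: measurable_fun_mx => i j.
rewrite (_ : (fun _ => _) = (fun v : 'cV[R]_n.+1 => v (lift ord0 i) ord0)).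
  exact: measurable_entry.
by apply/funext => v; rewrite mxE.
Qed.

Section lebesgue_step.
Variables (n : nat) (mu : {sigma_finite_measure set 'cV[R]_n -> \bar R}).

Definition lebesgue_step : set 'cV[R]_n.+1 -> \bar R :=
  pushforward (lebesgue_measure \x mu)%E (@vcons n).

Let step0 : lebesgue_step set0 = 0%E.
Proof. by rewrite /lebesgue_step /pushforward preimage_set0 measure0. Qed.

Let step_ge0 A : (0 <= lebesgue_step A)%E.
Proof. by rewrite /lebesgue_step /pushforward; exact: measure_ge0. Qed.

Let step_sigma_additive : semi_sigma_additive lebesgue_step.
Proof.
move=> F mF tF mUF; rewrite /lebesgue_step /pushforward preimage_bigcup.
have mP A : measurable A -> measurable (@vcons n @^-1` A).
  by move=> mA; rewrite -[X in measurable X]setTI; exact: measurable_vcons.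
apply: measure_semi_sigma_additive => [k||].
- exact: mP.
- apply/trivIsetP => /= i j _ _ ij; rewrite -preimage_setI.
  by move/trivIsetP : tF => /(_ _ _ _ _ ij) ->//; rewrite preimage_set0.
- by rewrite -preimage_bigcup; exact: mP.
Qed.

HB.instance Definition _ := isMeasure.Build _ _ _ lebesgue_step
  step0 step_ge0 step_sigma_additive.

Let step_sigma_finite : sigma_finite setT lebesgue_step.
Proof.
have /sigma_finiteP[F [TF ndF Foo]] := sigma_finiteT (@lebesgue_measure R).
have /sigma_finiteP[G [TG ndG Goo]] := sigma_finiteT mu.
exists (fun k => @vuncons n @^-1` (F k `*` G k)).
  rewrite predeqE => v; split=> // _.
  have [[k _ Fk] [l _ Gl]] : (\bigcup_i F i) (vuncons v).1 /\
    (\bigcup_i G i) (vuncons v).2 by rewrite -TF -TG.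
  exists (maxn k l) => //; split.
  - by move: Fk; apply/subsetPset/ndF/leq_maxl.
  - by move: Gl; apply/subsetPset/ndG/leq_maxr.
move=> k; have [mF Fk] := Foo k; have [mG Gk] := Goo k; split.
  rewrite -[X in measurable X]setTI; apply: measurable_vuncons => //.
  exact: measurableX.
rewrite /lebesgue_step /pushforward -comp_preimage.
rewrite (_ : _ \o _ = id); last by apply/funext => p /=; rewrite vconsK.
by rewrite preimage_id product_measure1E// lte_mul_pinfty// ge0_fin_numE.
Qed.

HB.instance Definition _ := Measure_isSigmaFinite.Build _ _ _ lebesgue_step
  step_sigma_finite.

End lebesgue_step.

Fixpoint lebesgue_vec n : {sigma_finite_measure set 'cV[R]_n -> \bar R} :=
  match n with
  | 0 => \d_ (0 : 'cV[R]_0)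
  | n'.+1 => lebesgue_step (lebesgue_vec n')
  end.

End lebesgue_vector.

Section sobolev.
Context {R : realType} {d : nat}.
Local Notation E := 'cV[R]_d.
Local Notation mu := (lebesgue_vec R d).
Implicit Types (Om D : set E) (v f phi : E -> R) (G : E -> E).

Definition dotv (a b : E) : R := \sum_(i < d) a i ord0 * b i ord0.

(* Euclidean norm; the library norm `|a| on matrices is the sup norm *)
Definition enorm (a : E) : R := Num.sqrt (dotv a a).

Definition partial (i : 'I_d) f : E -> R :=
  fun x => 'D_(delta_mx i ord0) f x.

Fixpoint Ck (k : nat) f : Prop :=
  match k with
  | 0 => continuous f
  | k'.+1 => forall i : 'I_d,
      (forall x, derivable f x (delta_mx i ord0)) /\ Ck k' (partial i f)
  end.

Definition test_function Om phi : Prop :=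
  [/\ forall k, Ck k phi,
      compact (closure [set x | phi x != 0])
    & closure [set x | phi x != 0] `<=` Om].

Definition L2norm D f : \bar R := Lnorm mu 2%:E (fun x => (f x * \1_D x)%:E).

Definition Linfnorm D f : \bar R := Lnorm mu +oo%E (fun x => (f x * \1_D x)%:E).

Definition in_L2 D f : Prop := measurable_fun D f /\ (L2norm D f < +oo)%E.

(* real-valued; only meant for functions that are L^2 on D *)
Definition norm0 D f : R := fine (L2norm D f).

Definition weak_gradient Om v G : Prop :=
  forall i : 'I_d, in_L2 Om (fun x => G x i ord0) /\
  forall phi, test_function Om phi ->
    Rintegral mu Om (fun x => v x * partial i phi x)
    = - Rintegral mu Om (fun x => G x i ord0 * phi x).

Definition H1 Om v : Prop :=
  in_L2 Om v /\ exists G, weak_gradient Om v G.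

(* a representative of the weak gradient on Om, unique up to null sets *)
Definition wgrad Om v : E -> E :=
  xget (fun=> 0) [set G | weak_gradient Om v G].

(* H^1-seminorm over D `<=` Om of a function of H^1(Om) *)
Definition semi1 Om D v : R := norm0 D (fun x => enorm (wgrad Om v x)).

(* closure of C_c^oo(Om) in H^1(Om) *)
Definition H10 Om v : Prop :=
  H1 Om v /\
  exists phi : nat -> E -> R,
    [/\ forall n, test_function Om (phi n),
        (fun n => norm0 Om (fun x => v x - phi n x)) @ \oo --> (0 : R)
      & (fun n => semi1 Om Om (fun x => v x - phi n x)) @ \oo --> (0 : R)].

(* elements of H1, H10 are representatives; their equality is that of classes *)
Definition eqae Om (u v : E -> R) : Prop := {ae mu, forall x, Om x -> u x = v x}.

End sobolev.

Section coefficient.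
Context {R : realType} {d : nat}.
Local Notation E := 'cV[R]_d.

Definition coeff_s (alpha : E -> R -> 'M[R]_d) (x : E) (s : R) : 'M[R]_d :=
  derive1 (alpha x) s.

(* boundedness in x is part of [coeff_bounded] *)
Record admissible_coeff (Om : set E) (alpha : E -> R -> 'M[R]_d)
    (Lam0 Lam1 lam : R) : Prop := {
  coeff_measurable : forall (s : R) (i j : 'I_d),
    measurable_fun Om (fun x => alpha x s i j);
  coeff_derivable : forall x s, Om x -> derivable (alpha x) s 1;
  coeff_derivable2 : forall x s, Om x -> derivable (coeff_s alpha x) s 1;
  coeff_lipschitz : forall x s1 s2 psi, Om x ->
    enorm ((alpha x s1 - alpha x s2) *m psi)
      <= Lam0 * `|s1 - s2| * enorm psi;
  coeff_coercive : forall x s psi, Om x ->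
    lam * enorm psi ^+ 2 <= dotv (alpha x s *m psi) psi;
  coeff_bounded : forall x s psi, Om x ->
    enorm (alpha x s *m psi) <= Lam1 * enorm psi }.

Definition A_L (Om : set E) (alpha : E -> R -> 'M[R]_d) (p v w : E -> R) : R :=
  Rintegral (lebesgue_vec R d) Om (fun x =>
    dotv (alpha x (p x) *m wgrad Om v x
          + v x *: (coeff_s alpha x (p x) *m wgrad Om p x))
         (wgrad Om w x)).

End coefficient.

Section mesh.
Context {R : realType} {d : nat}.
Local Notation E := 'cV[R]_d.

Inductive cell_kind := Simplex | Quadrilateral.

Definition ref_cell (c : cell_kind) : set E :=
  match c with
  | Simplex => [set x | (forall i, 0 <= x i ord0) /\ \sum_(i < d) x i ord0 <= 1]
  | Quadrilateral => [set x | forall i, 0 <= x i ord0 <= 1]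
  end.

(* lowest-order shape functions on the reference cell: P1, resp. Q1 *)
Definition ref_shape (c : cell_kind) : set (E -> R) :=
  match c with
  | Simplex => [set q | exists (c0 : R) (a : E), q = (fun x => c0 + dotv a x)]
  | Quadrilateral => [set q | exists cf : {set 'I_d} -> R,
      q = (fun x : E => \sum_(S : {set 'I_d}) cf S * \prod_(i in S) x i ord0)]
  end.

(* elements are the images of the reference cell under the charts *)
Record mesh := Mesh {
  kind : cell_kind;
  nelt : nat;
  chart : 'I_nelt -> E -> E }.

Definition elt (T : mesh) (k : 'I_(nelt T)) : set E :=
  chart k @` ref_cell (kind T).

Definition diam (A : set E) : R :=
  sup [set r | exists x y, [/\ A x, A y & r = enorm (x - y)]].

Definition mesh_size (T : mesh) : R :=
  \big[Num.max/0]_(k < nelt T) diam (elt k).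

(* charts are affine for simplices and multilinear for quadrilaterals *)
Record partition_of (Om : set E) (T : mesh) : Prop := {
  chart_shape : forall k i,
    ref_shape (kind T) (fun x => @chart T k x i ord0);
  chart_inj : forall k, set_inj (ref_cell (kind T)) (@chart T k);
  mesh_cover : closure Om = \bigcup_k @elt T k;
  mesh_disjoint : forall k l : 'I_(nelt T), k != l ->
    interior (elt k) `&` interior (elt l) = set0 }.

Definition shape_regular (sigma : R) (T : mesh) : Prop :=
  forall k : 'I_(nelt T), exists (c : E) (r : R),
    [/\ 0 < r, [set y | enorm (y - c) <= r] `<=` elt k
      & diam (elt k) <= sigma * r].

Definition quasi_uniform (tau : R) (T : mesh) : Prop :=
  forall k : 'I_(nelt T), mesh_size T <= tau * diam (elt k).

Definition elt_patch (T : mesh) (k : 'I_(nelt T)) : set E :=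
  \bigcup_(l in [set l : 'I_(nelt T) | elt l `&` elt k !=set0]) elt l.

(* largest number of patches N(K) with a common point *)
Definition patch_overlap (T : mesh) : nat :=
  \max_(S : {set 'I_(nelt T)} |
          `[< exists x, forall k, k \in S -> elt_patch k x >]) #|S|.

Definition V_H (Om : set E) (T : mesh) (v : E -> R) : Prop :=
  H10 Om v /\
  forall k : 'I_(nelt T), exists2 q, ref_shape (kind T) q &
    {ae lebesgue_vec R d, forall x, Om x -> forall xi,
       ref_cell (kind T) xi -> chart k xi = x -> v x = q xi}.

(* bounded local linear projection H^1_0(Om) -> V_H; C is the constant of the
   two interpolation estimates. Elements and patches are intersected with Om,
   since only values on Om are relevant. *)
Record interpolation (Om : set E) (T : mesh)
    (IH : (E -> R) -> (E -> R)) (C : R) : Prop := {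
  interp_V_H : forall v, H10 Om v -> V_H Om T (IH v);
  interp_eqae : forall u v, H10 Om u -> H10 Om v ->
    eqae Om u v -> eqae Om (IH u) (IH v);
  interp_linear : forall (a : R) u v, H10 Om u -> H10 Om v ->
    eqae Om (IH (fun x => a * u x + v x)) (fun x => a * IH u x + IH v x);
  interp_proj : forall v, V_H Om T v -> eqae Om (IH v) v;
  interp_stable : forall v (k : 'I_(nelt T)), H10 Om v ->
    semi1 Om (Om `&` elt k) (IH v) <= C * semi1 Om (Om `&` elt_patch k) v;
  interp_approx : forall v (k : 'I_(nelt T)), H10 Om v ->
    norm0 (Om `&` elt k) (fun x => v x - IH v x)
      <= C * mesh_size T * semi1 Om (Om `&` elt_patch k) v }.

(* Squaring the local L^2 estimates and summing over the elements gives
   ||v - I_H v||_0 <= interp_const T C * H * |v|_1 on the whole of Om. *)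
Definition interp_const (T : mesh) (C : R) : R :=
  Num.sqrt (patch_overlap T)%:R * C.

Definition interp_ker (Om : set E) (IH : (E -> R) -> (E -> R)) : set (E -> R) :=
  [set w | H10 Om w /\ eqae Om (IH w) (fun=> 0)].

End mesh.
Arguments mesh R d : clear implicits.

(* Main.v *)
Require Import Defs.
From mathcomp Require Import all_boot all_order all_algebra.
From mathcomp Require Import all_classical all_reals all_analysis.
From mathcomp Require Import measurable_realfun ess_sup_inf.
From mathcomp Require Import ring lra.
Import Order.TTheory GRing.Theory Num.Theory numFieldNormedType.Exports.
Local Open Scope classical_set_scope.
Local Open Scope ring_scope.
Set Implicit Arguments.
Unset Strict Implicit.
Unset Printing Implicit Defensive.

(** Write the form as a diffusion term plus a drift term,

      A_L(p,w,w) = int alpha(x,p) grad w . grad w + int w (b . grad w),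

    with b = alpha_s(x,p) grad p. Ellipticity bounds the diffusion term from
    below by lam |w|_1^2 ([diffusion_bound]). Since |b| <= Cp almost everywhere,
    the Cauchy-Schwarz inequality bounds the drift term by Cp ||w||_0 |w|_1
    ([drift_bound]). Nothing makes Cp small compared with lam, so on all of
    H^1_0 the drift may win. On the kernel of the interpolation operator,
    however, w = w - I_H w, and the approximation property acts as a Poincare
    inequality with a small constant, ||w||_0 <= C_I H |w|_1
    ([norm0_interp_ker]). Hence

      A_L(p,w,w) >= (lam - C_I Cp H) |w|_1^2,

    and the factor lam (1 - C_I (Cp / lam) H) is positive.

    The Poincare inequality is global while the approximation property is local:
    the squared local estimates are summed over the elements, which cover Om,
    and each point lies in at most [patch_overlap T] of the patches on the
    right-hand side ([integral_le_sum_cover], [sum_integral_le_overlap]).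

    These estimates split, compare and sum integrals, so everything in sight has
    to be measurable. Open sets are, being countable unions of rational boxes;
    elements are, as continuous images of compact reference cells; and
    x |-> alpha(x, p(x)) is, because alpha is measurable in x and continuous
    in s ([measurable_caratheodory]), after which alpha_s is a pointwise limit
    of difference quotients. *)

(** * Measurability of open sets and of mesh elements *)

Lemma cvg_mx_entries (R : numFieldType) (I : Type) (F : set_system I)
  {FF : Filter F} m n (f : I -> 'M[R]_(m, n)) (M : 'M[R]_(m, n)) :
  (forall i j, f x i j @[x --> F] --> M i j) -> f x @[x --> F] --> M.
Proof.
move=> fM; apply/cvg_ballP => e e0.
have : \forall x \near F, forall ij : 'I_m * 'I_n,
    ball (M ij.1 ij.2) e (f x ij.1 ij.2).
  by apply: filter_forall => -[i j]; move/cvg_ballP: (fM i j); apply.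
by apply: filterS => x xF; split=> // i j; exact: (xF (i, j)).
Qed.

(** The sigma-algebra on matrices is generated by the entries; the boxes with
    rational centre and radius 1/(k+1) belong to it, and countably many of them
    exhaust an open set. *)
Lemma open_measurable_mx (R : realType) m n (U : set 'M[R]_(m, n)) :
  open U -> measurable U.
Proof.
move=> oU.
pose F (q : 'M[rat]_(m, n) * nat) : set 'M[R]_(m, n) :=
  [set y | forall i j, ball (ratr (q.1 i j) : R) q.2.+1%:R^-1 (y i j)].
have mF q : measurable (F q).
  rewrite (_ : F q = \bigcap_(ij in [set: 'I_m * 'I_n])
    ((fun M : 'M[R]_(m, n) => M ij.1 ij.2) @^-1`
      ball (ratr (q.1 ij.1 ij.2) : R) q.2.+1%:R^-1)).
    apply: fin_bigcap_measurable => // ij _.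
    rewrite -[X in measurable X]setTI; apply: measurable_entry => //.
    exact: measurable_ball.
  apply/seteqP; split => [y yF [i j] _|y yF i j]; first exact: yF.
  exact: (yF (i, j)).
rewrite (_ : U = \bigcup_q (if `[< F q `<=` U >] then F q else set0)).
  apply: countable_bigcupT_measurable => // q; case: ifP => // _.
apply/seteqP; split => [x Ux|x [q _]]; last by case: ifPn => // /asboolP; apply.
move: oU; rewrite openE => /(_ _ Ux) /nbhs_ballP[e /= e0 xeU].
have [k ke] : exists k, k.+1%:R^-1 < e / 2 :> R.
  have e20 : 0 < e / 2 by rewrite divr_gt0.
  have [k _ kP] := near_infty_natSinv_lt (PosNum e20).
  by exists k; exact: kP (leqnn k).
have k0 : 0 < k.+1%:R^-1 :> R by rewrite invr_gt0.
have /choice[q qP] : forall ij : 'I_m * 'I_n, exists q : rat,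
    ball (x ij.1 ij.2) k.+1%:R^-1 (ratr q : R).
  move=> ij.
  have [||y [xy [q _ qy]]] := @dense_rat R (ball (x ij.1 ij.2) k.+1%:R^-1).
  - by exists (x ij.1 ij.2); exact: ballxx.
  - exact: ball_open.
  by exists q; rewrite qy.
exists (\matrix_(i, j) q (i, j), k) => //.
rewrite ifT.
  by move=> i j /=; rewrite mxE; apply: ball_sym; exact: (qP (i, j)).
(* the box contains x and has radius below e / 2, so it lies in ball x e *)
apply/asboolP => y yF; apply: xeU; split=> // i j.
rewrite (splitr e); apply: ball_triangle.
  by apply: le_ball (ltW ke) _ _; exact: (qP (i, j)).
by apply: le_ball (ltW ke) _ _; have := yF i j; rewrite /= mxE.
Qed.

Lemma continuous_sumr (R : realType) (E : topologicalType) (I : Type)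
  (r : seq I) (f : I -> E -> R) :
  (forall i, continuous (f i)) -> continuous (fun x => \sum_(i <- r) f i x).
Proof.
move=> cf; apply: (continuous_big (op := +%R)) => [|i _]; last exact: cf.
exact: pseudometric_normed_Zmodule.add_continuous.
Qed.

(** Charts are built from shape functions, hence are continuous maps. *)
Lemma continuous_ref_shape (R : realType) (d : nat) c (q : 'cV[R]_d -> R) :
  ref_shape c q -> continuous q.
Proof.
have coordC i : continuous (fun x : 'cV[R]_d => x i ord0).
  exact: coord_continuous.
case: c => [[c0 [a ->]]|[cf ->]] x.
  apply: continuousD; first exact: cst_continuous.
  apply: (@continuous_sumr _ _ _ _
    (fun i (x : 'cV[R]_d) => a i ord0 * x i ord0)) => i y.
  by apply: continuousM; [exact: cst_continuous|exact: coordC].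
apply: continuous_sumr => S y.
apply: continuousM; first exact: cst_continuous.
apply: (@continuous_big R _ *%R 1 (fun i => i \in S) _ _ _
  (fun i (x : 'cV[R]_d) => x i ord0)) => [|i _]; last exact: coordC.
by move=> z; apply: cvgM; [exact: cvg_fst|exact: cvg_snd].
Qed.

Lemma compact_ref_cell (R : realType) (d : nat) c : compact (@ref_cell R d c).
Proof.
have cmp_box : compact [set x : 'cV[R]_d | forall i, 0 <= x i ord0 <= 1].
  rewrite (_ : mkset _ = trmx @`
      [set v : 'rV[R]_d | forall i, `[0, 1]%classic (v ord0 i)]).
    apply: continuous_compact.
      apply: continuous_subspaceT => v.
      apply: (@cvg_mx_entries _ _ _ (nbhs_filter v)) => i j.
      rewrite mxE (_ : (fun x : 'rV[R]_d => _) = (fun x : 'rV[R]_d => x j i)).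
        exact: coord_continuous.
      by apply/funext => x; rewrite mxE.
    exact: (rV_compact (fun _ => @segment_compact R 0 1)).
  apply/seteqP; split => [x xP|_ [v vP <-] i].
    exists x^T; last exact: trmxK.
    by move=> i /=; rewrite mxE in_itv; exact: xP.
  by rewrite mxE; have := vP i; rewrite /= in_itv.
case: c => //=.
(* the simplex is a closed subset of the unit box *)
apply: (subclosed_compact _ cmp_box).
  rewrite [X in closed X](_ : _ =
    (\bigcap_i (fun x : 'cV[R]_d => x i ord0) @^-1` [set t | 0 <= t]) `&`
    (fun x : 'cV[R]_d => \sum_(i < d) x i ord0) @^-1` [set t | t <= 1]).
    apply: closedI; first apply: closed_bigI => i _.
      apply: preimage_closed; last exact: closed_ge.
      by move=> x _; exact: coord_continuous.
    apply: preimage_closed; last exact: closed_le.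
    by move=> x _; apply: continuous_sumr => i; exact: coord_continuous.
  by apply/seteqP; split => x [x0 x1]; split=> // i *; exact: x0.
move=> x [x0 x1] i; rewrite x0; apply: le_trans x1.
by rewrite (bigD1 i)//= lerDl sumr_ge0.
Qed.

Lemma measurable_elt (R : realType) (d : nat) (Om : set 'cV[R]_d)
  (T : mesh R d) (k : 'I_(nelt T)) : partition_of Om T -> measurable (elt k).
Proof.
move=> hT; rewrite -[elt k]setCK; apply: measurableC; apply: open_measurable_mx.
rewrite openC; apply: compact_closed; first exact: norm_hausdorff.
apply: continuous_compact; last exact: compact_ref_cell.
apply: continuous_subspaceT => x.
apply: (@cvg_mx_entries _ _ _ (nbhs_filter x)) => i j.
by rewrite ord1; exact: continuous_ref_shape (chart_shape hT k i) x.
Qed.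

Lemma measurable_elt_patch (R : realType) (d : nat) (Om : set 'cV[R]_d)
  (T : mesh R d) (k : 'I_(nelt T)) :
  partition_of Om T -> measurable (elt_patch k).
Proof.
move=> hT; apply: fin_bigcup_measurable => // l _; exact: measurable_elt hT.
Qed.

(** * Measurability of the coefficients along a function *)

(** Rounding p down to the grid of mesh 1/(n+1) gives a function with countably
    many values, along which a is measurable piece by piece; as n grows,
    continuity in s recovers the value at p itself. *)
Lemma measurable_caratheodory (R : realType) d (E : measurableType d)
  (D : set E) (a : E -> R -> R) (p : E -> R) :
  (forall s, measurable_fun D (a ^~ s)) ->
  (forall x, D x -> continuous (a x)) -> measurable_fun D p ->
  measurable_fun D (fun x => a x (p x)).
Proof.
move=> ma ca mp.
pose pn n x : R := (Num.floor (n.+1%:R * p x))%:~R / n.+1%:R.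
apply: (@measurable_fun_cvg _ _ _ _ (fun n x => a x (pn n x))) => [n|x Dx];
  last first.
  apply: (cvg_comp (pn ^~ x)); last exact: ca.
  apply/cvgrPdist_le => e e0.
  near=> n.
  have n0 : 0 < n.+1%:R :> R by rewrite ltr0Sn.
  have /andP[fl fu] := floor_itv (n.+1%:R * p x).
  have -> : p x - pn n x =
      (n.+1%:R * p x - (Num.floor (n.+1%:R * p x))%:~R) / n.+1%:R.
    by rewrite mulrBl mulrAC divff ?mul1r// lt0r_neq0.
  rewrite ger0_norm; last by rewrite divr_ge0 ?subr_ge0// ltW.
  apply: (@le_trans _ _ n.+1%:R^-1).
    rewrite ler_piMl ?invr_ge0 ?ler0n//.
    by rewrite lerBlDl ltW// (lt_le_trans fu)// intrD.
  apply: ltW; near: n; exact: (near_infty_natSinv_lt (PosNum e0)).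
move=> mD Y mY.
pose F (k : int) := (D `&` (fun x => n.+1%:R * p x) @^-1` `[k%:~R, (k + 1)%:~R[)
  `&` (D `&` (a ^~ (k%:~R / n.+1%:R)) @^-1` Y).
rewrite (_ : _ `&` _ = \bigcup_k F k).
  apply: countable_bigcupT_measurable => // k; apply: measurableI.
    by apply: (measurable_funM (measurable_cst _) mp) => //;
      exact: measurable_itv.
  exact: ma.
apply/seteqP; split => [x [Dx Yx]|x [k _ [[Dx /=]]]].
  exists (Num.floor (n.+1%:R * p x)) => //; split; split => //=.
  by rewrite in_itv/= floor_itv.
rewrite in_itv/= => /andP[kl ku] [_ Yx]; split => //=.
by rewrite /pn (@floor_def _ _ k)// kl ku.
Unshelve. all: by end_near. Qed.

Lemma measurable_coeff (R : realType) d (Om : set 'cV[R]_d) alpha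
  Lam0 Lam1 lam p i j :
  admissible_coeff Om alpha Lam0 Lam1 lam -> measurable_fun Om p ->
  measurable_fun Om (fun x => alpha x (p x) i j).
Proof.
move=> halpha mp.
apply: (measurable_caratheodory (a := fun x s => alpha x s i j)) => //
  [s|x Ox s].
  exact: coeff_measurable halpha s i j.
have /derivable1_diffP/differentiable_continuous :=
  coeff_derivable halpha (s := s) Ox.
move=> /(continuous_comp (g := fun M : 'M[R]_d => M i j)); apply.
exact: coord_continuous.
Qed.

(** Pointwise limit, as n grows, of the difference quotients of step 1/(n+1). *)
Lemma measurable_coeff_s (R : realType) d (Om : set 'cV[R]_d) alpha
  Lam0 Lam1 lam p i j :
  admissible_coeff Om alpha Lam0 Lam1 lam -> measurable_fun Om p ->
  measurable_fun Om (fun x => coeff_s alpha x (p x) i j).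
Proof.
move=> halpha mp.
pose h n x : R :=
  n.+1%:R * (alpha x (n.+1%:R^-1 + p x) i j - alpha x (p x) i j).
apply: (@measurable_fun_cvg _ _ _ _ h) => [n|x Ox].
  apply: measurable_funM; first exact: measurable_cst.
  apply: measurable_funB; apply: measurable_coeff halpha _ => //.
  by apply: measurable_funD => //; exact: measurable_cst.
have dq := coeff_derivable halpha (s := p x) Ox.
have : h^-1 *: (alpha x (h + p x) - alpha x (p x)) @[h --> 0^'] -->
    coeff_s alpha x (p x).
  move: dq; rewrite /derivable.
  under [in X in cvg X]eq_fun do rewrite /= [_ *: 1]mulr1.
  exact.
have h0 : harmonic @ \oo --> (0 : R)^'.
  move=> A A0; have /cvg_harmonic : nbhs (0 : R) [set y | y != 0 -> A y] := A0.
  rewrite /nbhs/=; apply: filterS => n /=; apply.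
  by rewrite invr_neq0// pnatr_eq0.
move=> /(cvg_comp _ _ h0)/(cvg_comp _ _)/(_ (@coord_continuous R d d i j _)).
apply: cvg_trans; apply: near_eq_cvg; apply: nearW => n.
by rewrite /h /= !mxE invrK.
Qed.

(** * Euclidean inner product *)

Section vectors.
Variables (R : realType) (d : nat).
Implicit Types a b : 'cV[R]_d.

Lemma dotvv_ge0 a : 0 <= dotv a a.
Proof. by apply: sumr_ge0 => i _; rewrite -expr2 sqr_ge0. Qed.

Lemma enorm_sqr a : enorm a ^+ 2 = dotv a a.
Proof. by rewrite sqr_sqrtr ?dotvv_ge0. Qed.

Lemma enorm_ge0 a : 0 <= enorm a.
Proof. exact: sqrtr_ge0. Qed.

(** Lagrange's identity: the difference of the squares is half the sum of all
    (a_i b_j - a_j b_i)^2. *)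
Lemma normr_dotv_le a b : `|dotv a b| <= enorm a * enorm b.
Proof.
rewrite -(@ler_pXn2r _ 2)// ?nnegrE ?mulr_ge0 ?enorm_ge0//.
rewrite real_normK ?num_real// exprMn !enorm_sqr -(@ler_pM2l _ 2)//.
have -> : 2 * dotv a b ^+ 2 =
    \sum_i \sum_j 2 * (a i ord0 * b i ord0) * (a j ord0 * b j ord0).
  rewrite expr2 /dotv big_distrlr/= mulr_sumr; apply: eq_bigr => i _.
  by rewrite mulr_sumr; apply: eq_bigr => j _; rewrite mulrA.
have -> : 2 * (dotv a a * dotv b b) = \sum_i \sum_j
    (a i ord0 ^+ 2 * b j ord0 ^+ 2 + a j ord0 ^+ 2 * b i ord0 ^+ 2).
  rewrite mulr_natl mulr2n {2}[dotv a a * _]mulrC /dotv !big_distrlr/=.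
  rewrite -big_split/=; apply: eq_bigr => i _; rewrite -big_split/=.
  by apply: eq_bigr => j _; rewrite !expr2 [X in _ + X]mulrC.
apply: ler_sum => i _; apply: ler_sum => j _; rewrite -subr_ge0.
have -> : forall x y z t : R,
    x ^+ 2 * t ^+ 2 + z ^+ 2 * y ^+ 2 - 2 * (x * y) * (z * t)
    = (x * t - z * y) ^+ 2.
  by move=> x y z t; ring.
exact: sqr_ge0.
Qed.

Lemma dotvDl a b c : dotv (a + b) c = dotv a c + dotv b c.
Proof.
by rewrite -big_split; apply: eq_bigr => i _; rewrite mxE mulrDl.
Qed.

Lemma dotvZl (t : R) a b : dotv (t *: a) b = t * dotv a b.
Proof. by rewrite mulr_sumr; apply: eq_bigr => i _; rewrite mxE mulrA. Qed.

End vectors.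

(** * Square-integrable functions *)

Section square_integrable.
Variables (R : realType) (d : nat).
Local Notation E := 'cV[R]_d.
Local Notation mu := (lebesgue_vec R d).
Implicit Types (D : set E) (f g : E -> R) (G : E -> E).

(** Turns norms over a subdomain into integrals of squares, which can be
    compared and added. *)
Lemma L2norm_sqr D f :
  (L2norm D f ^+ 2 = \int[mu]_(x in D) (f x ^+ 2)%:E)%E.
Proof.
have -> : (L2norm D f ^+ 2 = L2norm D f `^ 2%:R)%E.
  have := Lnorm_ge0 mu 2%:E (fun x => (f x * \1_D x)%:E).
  rewrite -/(L2norm D f).
  case: (L2norm D f) => [r r0|_|]//=; last by rewrite pnatr_eq0.
  by rewrite powR_mulrn// -EFin_expe.
rewrite /L2norm poweR_Lnorm// [RHS]integral_mkcond; apply: eq_integral => x _.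
rewrite epatch_indic/= powR_mulrn// real_normK ?num_real// exprMn EFinM.
by rewrite indicE; case: (_ \in _); rewrite /= ?expr1n ?expr0n.
Qed.

Lemma in_L2P D f : in_L2 D f <->
  measurable_fun D f /\ (\int[mu]_(x in D) (f x ^+ 2)%:E < +oo)%E.
Proof.
rewrite /in_L2 -L2norm_sqr.
have := Lnorm_ge0 mu 2%:E (fun x => (f x * \1_D x)%:E); rewrite -/(L2norm D f).
by case: (L2norm D f) => [r _|_|]//; rewrite expe2 -EFinM !ltry.
Qed.

Lemma L2norm_norm0 D f : in_L2 D f -> L2norm D f = (norm0 D f)%:E.
Proof.
move=> [_ foo]; rewrite fineK// ge0_fin_numE//; exact: Lnorm_ge0.
Qed.

Lemma norm0_ge0 D f : 0 <= norm0 D f.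
Proof. by apply: fine_ge0; exact: Lnorm_ge0. Qed.

Lemma norm0_sqr D f : in_L2 D f ->
  (norm0 D f ^+ 2)%:E = (\int[mu]_(x in D) (f x ^+ 2)%:E)%E.
Proof. by move=> f2; rewrite EFin_expe -L2norm_norm0// L2norm_sqr. Qed.

Lemma measurable_sqr D f : measurable_fun D f ->
  measurable_fun D (fun x => (f x ^+ 2)%:E).
Proof. by move=> mf; apply/measurable_EFinP; exact: measurable_funX. Qed.

Lemma in_L2_subset A D f : measurable A -> measurable D -> A `<=` D ->
  in_L2 D f -> in_L2 A f.
Proof.
move=> mA mD AD /in_L2P[mf foo]; apply/in_L2P; split.
  exact: measurable_funS mf.
apply: le_lt_trans foo; apply: ge0_subset_integral => //.
- exact: measurable_sqr.
- by move=> x _; rewrite lee_fin sqr_ge0.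
Qed.

Lemma in_L2_enorm D G : measurable D ->
  (forall i, in_L2 D (fun x => G x i ord0)) -> in_L2 D (fun x => enorm (G x)).
Proof.
move=> mD GL2.
have mG i : measurable_fun D (fun x => G x i ord0) by have [] := GL2 i.
apply/in_L2P; split.
  apply: (measurableT_comp (f := @Num.sqrt R)).
    by apply: continuous_measurable_fun; exact: sqrt_continuous.
  by apply: measurable_sum => i; exact: measurable_funM.
rewrite (_ : integral _ _ _ =
  \sum_(i < d) \int[mu]_(x in D) (G x i ord0 ^+ 2)%:E)%E.
  apply: lte_sum_pinfty => i _; exact: ((in_L2P _ _).1 (GL2 i)).2.
rewrite -ge0_integral_sum//.
- apply: eq_integral => x _; rewrite enorm_sqr sumEFin.
  by congr EFin; apply: eq_bigr => i _; rewrite expr2.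
- by move=> i; exact: measurable_sqr.
- by move=> i x _; rewrite lee_fin sqr_ge0.
Qed.

(** Almost everywhere equal measurable functions have the same integral of
    squares, so f is in L^2 along with g. This is what replaces w - I_H w by w
    when I_H w vanishes almost everywhere. *)
Lemma norm0_ae_eq D f g : measurable D -> measurable_fun D f -> in_L2 D g ->
  eqae D f g -> norm0 D f = norm0 D g.
Proof.
move=> mD mf g2 fg.
have fgE : (\int[mu]_(x in D) (f x ^+ 2)%:E =
    \int[mu]_(x in D) (g x ^+ 2)%:E)%E.
  apply: ge0_ae_eq_integral => //.
  - exact: measurable_sqr.
  - by apply: measurable_sqr; case: g2.
  - by move=> x _; rewrite lee_fin sqr_ge0.
  - by move=> x _; rewrite lee_fin sqr_ge0.
  - by apply: filterS fg => x fgx Dx; rewrite fgx.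
have f2 : in_L2 D f.
  by apply/in_L2P; split=> //; rewrite fgE; exact: ((in_L2P _ _).1 g2).2.
have : (norm0 D f ^+ 2)%:E = (norm0 D g ^+ 2)%:E by rewrite !norm0_sqr.
by move=> [] /eqP; rewrite eqrXn2 ?norm0_ge0// => /eqP.
Qed.

Lemma cauchy_schwarz_L2 D f g : measurable D -> in_L2 D f -> in_L2 D g ->
  (\int[mu]_(x in D) `|f x * g x|%:E <= (norm0 D f * norm0 D g)%:E)%E.
Proof.
move=> mD f2 g2.
have m1 h : in_L2 D h -> measurable_fun setT (fun x => h x * \1_D x).
  move=> [mh _]; rewrite -[X in measurable_fun _ X](patch_indic h D).
  by apply/(measurable_restrictT _ _).1.
have := @hoelder _ _ _ mu (fun x => f x * \1_D x) (fun x => g x * \1_D x) 2 2.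
move=> /(_ (m1 _ f2) (m1 _ g2)).
rewrite -!/(L2norm _ _) !L2norm_norm0// -EFinM Lnorm1.
have half2 : 2^-1 + 2^-1 = 1 :> R by lra.
move=> /(_ (ltr0Sn _ _) (ltr0Sn _ _) half2); apply: le_trans.
rewrite le_eqVlt; apply/orP; left; apply/eqP.
rewrite [LHS]integral_mkcond; apply: eq_integral => x _.
rewrite epatch_indic/= indicE; case: (_ \in _); rewrite /= ?mulr1 ?mule1//.
by rewrite !mulr0 mule0 normr0.
Qed.

End square_integrable.

(** * Sums of integrals over overlapping sets *)

Section finite_family.
Context d (T : measurableType d) (R : realType).
Variable mu : {measure set T -> \bar R}.
Variables (I : finType) (D : set T) (B : I -> set T) (f : T -> \bar R).
Hypotheses (mD : measurable D) (mB : forall k, measurable (B k)).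
Hypotheses (f0 : forall x, D x -> (0 <= f x)%E) (mf : measurable_fun D f).

Let mfB k : measurable_fun D (f \_ (B k)).
Proof.
apply/measurable_restrict => //.
exact: (measurable_funS mD (@subIsetl _ _ _) mf).
Qed.

Let fB0 k x : D x -> (0 <= (f \_ (B k)) x)%E.
Proof. by move=> Dx; rewrite patchE; case: ifP => // _; exact: f0. Qed.

Lemma sum_integral_setI :
  (\sum_k \int[mu]_(x in D `&` B k) f x =
   \int[mu]_(x in D) (\sum_k (f \_ (B k)) x))%E.
Proof.
by rewrite ge0_integral_sum//; apply: eq_bigr => k _; rewrite integral_mkcondr.
Qed.

Lemma integral_le_sum_cover : D `<=` \bigcup_k B k ->
  (\int[mu]_(x in D) f x <= \sum_k \int[mu]_(x in D `&` B k) f x)%E.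
Proof.
move=> DB; rewrite sum_integral_setI; apply: ge0_le_integral => //.
  exact: emeasurable_sum.
move=> x Dx; have [k _ Bkx] := DB x Dx.
rewrite (bigD1 k)//= {1}patchE mem_set// leeDl// sume_ge0// => l _; exact: fB0.
Qed.

(** Exchanging sum and integral, f(x) is counted once for each k with x in B k. *)
Lemma sum_integral_le_overlap N :
  (forall x, D x -> (#|[pred k | `[< B k x >]]| <= N)%N) ->
  (\sum_k \int[mu]_(x in D `&` B k) f x <= N%:R%:E * \int[mu]_(x in D) f x)%E.
Proof.
move=> BN; rewrite sum_integral_setI -ge0_integralZl//.
apply: ge0_le_integral => //.
- by move=> x Dx; apply: sume_ge0 => k _; exact: fB0.
- exact: emeasurable_sum.
- exact: measurable_funeM.
move=> x Dx; rewrite (bigID (fun k => `[< B k x >]))/=.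
rewrite [X in (_ + X)%E]big1 ?adde0; last first.
  by move=> k /asboolPn Bkx; rewrite patchE memNset.
rewrite (eq_bigr (fun=> f x)); last first.
  by move=> k /asboolP Bkx; rewrite patchE mem_set.
(* the multiple in an abelian monoid is convertible to that of \bar R *)
rewrite sumr_const -[X in (X <= _)%E]/(f x *+ _)%E.
rewrite -mule_natl lee_wpmul2r ?f0// lee_fin ler_nat.
exact: BN.
Qed.

End finite_family.

(** * Bounds for the diffusion and the drift terms *)

Section weighted.
Variables (R : realType) (d : nat).
Local Notation E := 'cV[R]_d.
Local Notation mu := (lebesgue_vec R d).
Implicit Types (D : set E) (f g v : E -> R) (b G : E -> E).

Lemma Linfnorm_ge0 D f M : (Linfnorm D f <= M%:E)%E -> 0 <= M.
Proof. by move=> fM; rewrite -lee_fin (le_trans _ fM)//; exact: Lnorm_ge0. Qed.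

(** When the whole space is null the L^oo norm is 0 by convention, not an
    essential supremum; the bound then holds almost everywhere vacuously. *)
Lemma Linfnorm_ae D f M : (Linfnorm D f <= M%:E)%E ->
  {ae mu, forall x, D x -> `|f x| <= M}.
Proof.
move=> fM.
have : {ae mu, forall x, (`|(f x * \1_D x)%:E| <= M%:E)%E}.
  move: fM; rewrite /Linfnorm unlock; case: ifPn => [_ /ess_supP //|].
  rewrite -leNgt measure_le0 => /eqP mu0 _; exists setT; split => //.
by apply: filterS => x /= + Dx; rewrite indicE mem_set// mulr1.
Qed.

Lemma measurable_dotv D b G :
  (forall i, measurable_fun D (fun x => b x i ord0)) ->
  (forall i, measurable_fun D (fun x => G x i ord0)) ->
  measurable_fun D (fun x => dotv (b x) (G x)).
Proof. by move=> mb mG; apply: measurable_sum => i; exact: measurable_funM. Qed.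

Lemma measurable_mulmx D (A : E -> 'M[R]_d) G :
  (forall i j, measurable_fun D (fun x => A x i j)) ->
  (forall i, measurable_fun D (fun x => G x i ord0)) ->
  forall i, measurable_fun D (fun x => (A x *m G x) i ord0).
Proof.
move=> mA mG i; under eq_fun do rewrite mxE.
by apply: measurable_sum => j; exact: measurable_funM.
Qed.

(** Pointwise |v (b . G)| <= M |v| |G| almost everywhere, and Cauchy-Schwarz
    bounds the integral of |v| |G|. Integrability is part of the conclusion
    because adding the two terms of the form back together requires it. *)
Lemma drift_bound D v b G M : measurable D -> in_L2 D v ->
  (forall i, in_L2 D (fun x => G x i ord0)) ->
  (forall i, measurable_fun D (fun x => b x i ord0)) ->
  0 <= M -> {ae mu, forall x, D x -> enorm (b x) <= M} ->
  mu.-integrable D (fun x => (v x * dotv (b x) (G x))%:E) /\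
  `|Rintegral mu D (fun x => v x * dotv (b x) (G x))|
    <= M * (norm0 D v * norm0 D (fun x => enorm (G x))).
Proof.
move=> mD v2 G2 mb M0 bM.
have g2 := in_L2_enorm mD G2.
have mF : measurable_fun D (fun x => v x * dotv (b x) (G x)).
  apply: measurable_funM; first by case: v2.
  by apply: measurable_dotv => // i; case: (G2 i).
have leF : (\int[mu]_(x in D) `|(v x * dotv (b x) (G x))%:E|
    <= (M * (norm0 D v * norm0 D (fun x => enorm (G x))))%:E)%E.
  apply: (@le_trans _ _ (\int[mu]_(x in D) (M%:E * `|v x * enorm (G x)|%:E))%E).
    apply: ae_ge0_le_integral => //.
    - by apply: measurableT_comp => //; exact/measurable_EFinP.
    - by move=> x _; rewrite mule_ge0 ?lee_fin.
    - apply: measurable_funeM; apply/measurable_EFinP.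
      apply: measurableT_comp => //.
      by apply: measurable_funM; [case: v2|case: g2].
    apply: filterS bM => x bM Dx; rewrite lee_fin !normrM mulrCA.
    rewrite ler_wpM2l// (le_trans (normr_dotv_le _ _))//.
    by rewrite (ger0_norm (enorm_ge0 _)) ler_wpM2r ?enorm_ge0 ?bM.
  rewrite ge0_integralZl//.
    by rewrite EFinM lee_wpmul2l ?lee_fin//; exact: cauchy_schwarz_L2.
  apply/measurable_EFinP; apply: measurableT_comp => //.
  by apply: measurable_funM; [case: v2|case: g2].
have intF : mu.-integrable D (fun x => (v x * dotv (b x) (G x))%:E).
  apply/integrableP; split; first exact/measurable_EFinP.
  by apply: le_lt_trans leF _; rewrite ltry.
split=> //; rewrite (le_trans (le_normr_Rintegral _ _))// -lee_fin.
rewrite /Rintegral fineK//.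
by apply: integrable_fin_num => //; exact: (integrable_abse intF).
Qed.

(** The upper bound Lam makes the integrand integrable, being dominated by
    Lam |G|^2; the lower bound is ellipticity integrated over D. *)
Lemma diffusion_bound D (A : E -> 'M[R]_d) G lam Lam : measurable D ->
  (forall i j, measurable_fun D (fun x => A x i j)) ->
  (forall i, in_L2 D (fun x => G x i ord0)) ->
  (forall x psi, D x -> lam * enorm psi ^+ 2 <= dotv (A x *m psi) psi) ->
  (forall x psi, D x -> enorm (A x *m psi) <= Lam * enorm psi) ->
  mu.-integrable D (fun x => (dotv (A x *m G x) (G x))%:E) /\
  lam * norm0 D (fun x => enorm (G x)) ^+ 2
    <= Rintegral mu D (fun x => dotv (A x *m G x) (G x)).
Proof.
move=> mD mA G2 Alam ALam.
have g2 := in_L2_enorm mD G2.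
have mG i : measurable_fun D (fun x => G x i ord0) by case: (G2 i).
have intg : mu.-integrable D (fun x => (enorm (G x) ^+ 2)%:E).
  apply/integrableP; split; first by apply: measurable_sqr; case: g2.
  have [_] := (in_L2P _ _).1 g2; congr (_ < _)%E.
  by apply: eq_integral => x _; rewrite /= ger0_norm// sqr_ge0.
have intF : mu.-integrable D (fun x => (dotv (A x *m G x) (G x))%:E).
  apply: (@le_integrable _ _ _ mu D mD _
    (fun x => Lam%:E * (enorm (G x) ^+ 2)%:E)%E).
  - apply/measurable_EFinP; apply: measurable_dotv => //.
    exact: measurable_mulmx.
  - move=> x Dx; rewrite -EFinM lee_fin; apply: le_trans (ler_norm _).
    rewrite (le_trans (normr_dotv_le _ _))// expr2 mulrA.
    by rewrite ler_wpM2r ?enorm_ge0 ?ALam.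
  - exact: integrableZl.
split=> //.
rewrite (_ : _ ^+ 2 = Rintegral mu D (fun x => enorm (G x) ^+ 2)).
  rewrite -RintegralZl//; apply: le_Rintegral => // [|x Dx]; last exact: Alam.
  by have := integrableZl mD lam intg.
by rewrite /Rintegral -norm0_sqr.
Qed.

End weighted.

(** * Small Poincare constant on the kernel of the interpolation operator *)

Lemma weak_gradient_wgrad (R : realType) (d : nat) (Om : set 'cV[R]_d) v :
  H1 Om v -> weak_gradient Om v (wgrad Om v).
Proof. by move=> [_ [G vG]]; exact: (xgetPex (fun=> 0)) (ex_intro _ G vG). Qed.

Lemma wgrad_in_L2 (R : realType) (d : nat) (Om : set 'cV[R]_d) v i :
  H1 Om v -> in_L2 Om (fun x => wgrad Om v x i ord0).
Proof. by move=> /weak_gradient_wgrad /(_ i)[]. Qed.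

Lemma mesh_size_ge0 (R : realType) (d : nat) (T : mesh R d) : 0 <= mesh_size T.
Proof. by rewrite /mesh_size; apply: bigmax_ge_id. Qed.

(** The patches containing x form one of the families over which the overlap
    number is maximized. *)
Lemma card_elt_patch_le (R : realType) (d : nat) (T : mesh R d) x :
  (#|[pred k : 'I_(nelt T) | `[< elt_patch k x >]]| <= patch_overlap T)%N.
Proof.
set P := [pred k : 'I_(nelt T) | `[< elt_patch k x >]].
rewrite -(cardsE P); apply: leq_bigmax_cond.
by apply/asboolP; exists x => k; rewrite inE => /asboolP.
Qed.

Section kernel_estimate.
Variables (R : realType) (d : nat) (Om : set 'cV[R]_d) (T : mesh R d).
Variables (IH : ('cV[R]_d -> R) -> ('cV[R]_d -> R)) (C : R).
Local Notation mu := (lebesgue_vec R d).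

(** On the kernel, w and w - I_H w are the same class in L^2. *)
Lemma norm0_interp_ker_elt w (k : 'I_(nelt T)) :
  open Om -> partition_of Om T -> interpolation Om T IH C ->
  interp_ker Om IH w ->
  norm0 (Om `&` elt k) w <= C * mesh_size T * semi1 Om (Om `&` elt_patch k) w.
Proof.
move=> oOm hT hIH [w0 IHw0]; apply: le_trans (interp_approx hIH k w0).
have mOm := open_measurable_mx oOm.
have mk : measurable (Om `&` elt k).
  by apply: measurableI => //; exact: measurable_elt hT.
have [w2 _] := w0.1; have [[[mIHw _] _] _] := (interp_V_H hIH w0).1.
rewrite le_eqVlt (@norm0_ae_eq _ _ _ (fun x => w x - IH w x) w) ?eqxx//.
- apply: (measurable_funS mOm (@subIsetl _ _ _)).
  by apply: measurable_funB => //; case: w2.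
- exact: in_L2_subset w2.
- by apply: filterS IHw0 => x IHwx [Omx _]; rewrite IHwx// subr0.
Qed.

(** Squares of the local estimates add up over the elements; on the right-hand
    side each point of Om is counted at most [patch_overlap T] times, whence the
    factor sqrt(patch_overlap T) in [interp_const]. *)
Lemma norm0_interp_ker w :
  open Om -> partition_of Om T -> interpolation Om T IH C -> 0 <= C ->
  interp_ker Om IH w ->
  norm0 Om w <= interp_const T C * mesh_size T * semi1 Om Om w.
Proof.
move=> oOm hT hIH C0 kw; have [[H1w _] _] := kw.
have mOm := open_measurable_mx oOm.
have mE k : measurable (@elt R d T k) by exact: measurable_elt hT.
have mN k : measurable (@elt_patch R d T k) by exact: measurable_elt_patch hT.
pose g x := enorm (wgrad Om w x).
have w2 : in_L2 Om w by case: H1w.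
have g2 : in_L2 Om g by apply: in_L2_enorm => // i; exact: wgrad_in_L2.
have sub f B : measurable B -> in_L2 Om f -> in_L2 (Om `&` B) f.
  by move=> mB; apply: in_L2_subset => //; exact: measurableI.
have CH0 : 0 <= C * mesh_size T by rewrite mulr_ge0 ?mesh_size_ge0.
rewrite -(@ler_pXn2r _ 2)// ?nnegrE ?norm0_ge0//; last first.
  by rewrite !mulr_ge0 ?sqrtr_ge0 ?mesh_size_ge0 ?norm0_ge0.
have -> : (interp_const T C * mesh_size T * semi1 Om Om w) ^+ 2 =
    (C * mesh_size T) ^+ 2 * ((patch_overlap T)%:R * semi1 Om Om w ^+ 2).
  by rewrite -mulrA mulrC !exprMn sqr_sqrtr ?ler0n//; ring.
rewrite -lee_fin norm0_sqr//.
have sq0 (f : 'cV[R]_d -> R) x : Om x -> (0 <= (f x ^+ 2)%:E)%E.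
  by move=> _; rewrite lee_fin sqr_ge0.
apply: (@le_trans _ _
    (\sum_(k < nelt T) \int[mu]_(x in Om `&` elt k) (w x ^+ 2)%:E)%E).
  apply: integral_le_sum_cover => //; first exact: sq0.
    by apply: measurable_sqr; case: w2.
  by rewrite -(mesh_cover hT); exact: subset_closure.
apply: (@le_trans _ _ (\sum_(k < nelt T) ((C * mesh_size T) ^+ 2)%:E *
    \int[mu]_(x in Om `&` elt_patch k) (g x ^+ 2)%:E)%E).
  apply: lee_sum => k _; rewrite -!norm0_sqr; [|exact: sub|exact: sub].
  rewrite -EFinM lee_fin -exprMn ler_pXn2r// ?nnegrE ?mulr_ge0
    ?mesh_size_ge0 ?norm0_ge0//.
  exact: norm0_interp_ker_elt.
rewrite -ge0_sume_distrr => [|k _]; last first.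
  by apply: integral_ge0 => x _; rewrite lee_fin sqr_ge0.
rewrite [X in (_ <= X)%E]EFinM lee_wpmul2l ?lee_fin ?sqr_ge0//.
rewrite [X in (_ <= X)%E]EFinM norm0_sqr//.
apply: sum_integral_le_overlap => //.
- exact: sq0.
- by apply: measurable_sqr; case: g2.
- by move=> x _; exact: card_elt_patch_le.
Qed.

End kernel_estimate.

(** * Coercivity *)

Unset Implicit Arguments.

Theorem lemma2 (R : realType) (d : nat) (hd : (0 < d <= 3)%N)
  (Om : set 'cV[R]_d) (hOmne : Om !=set0) (hOmo : open Om)
  (hOmc : connected Om) (hOmb : bounded_set Om)
  (alpha : 'cV[R]_d -> R -> 'M[R]_d) (Lam0 Lam1 lam : R)
  (hLam0 : 0 < Lam0) (hLam1 : 0 < Lam1) (hlam : 0 < lam)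
  (halpha : admissible_coeff Om alpha Lam0 Lam1 lam)
  (T : mesh R d) (sigma tau : R)
  (hT : partition_of Om T) (hsr : shape_regular sigma T)
  (hqu : quasi_uniform tau T)
  (IH : ('cV[R]_d -> R) -> ('cV[R]_d -> R)) (C : R) (hC : 0 < C)
  (hIH : interpolation Om T IH C)
  (pstar : 'cV[R]_d -> R) (hp : H10 Om pstar) (Cp : R)
  (hCp : (Linfnorm Om (fun x =>
            enorm (coeff_s alpha x (pstar x) *m wgrad Om pstar x))%R
          <= Cp%:E)%E) :
  let C_I := interp_const T C in
  C_I * (Cp / lam) * mesh_size T < 1 ->
  exists2 c : R, 0 < c &
    forall w, interp_ker Om IH w ->
      c * semi1 Om Om w ^+ 2 <= A_L Om alpha pstar w w.
Proof.
move=> C_I smallH.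
have mOm := open_measurable_mx hOmo.
exists (lam * (1 - C_I * (Cp / lam) * mesh_size T)).
  by rewrite mulr_gt0// subr_gt0.
move=> w kw; have [[H1w _] _] := kw; have [w2 _] := H1w.
have [H1p _] := hp; have [[mp _] _] := H1p.
have Dw2 i := wgrad_in_L2 i H1w.
have mDp i : measurable_fun Om (fun x => wgrad Om pstar x i ord0).
  by case: (wgrad_in_L2 i H1p).
have Cp0 := Linfnorm_ge0 hCp.
have bCp : {ae lebesgue_vec R d, forall x, Om x ->
    enorm (coeff_s alpha x (pstar x) *m wgrad Om pstar x) <= Cp}.
  apply: filterS (Linfnorm_ae hCp) => x bx Omx.
  by rewrite -(ger0_norm (enorm_ge0 _)) bx.
have [intA leA] := diffusion_bound mOm
  (fun i j => measurable_coeff i j halpha mp) Dw2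
  (fun x psi Omx => coeff_coercive halpha _ psi Omx)
  (fun x psi Omx => coeff_bounded halpha _ psi Omx).
have [intB leB] := drift_bound mOm w2 Dw2
  (measurable_mulmx (fun i j => measurable_coeff_s i j halpha mp) mDp) Cp0 bCp.
have -> : A_L Om alpha pstar w w =
    Rintegral (lebesgue_vec R d) Om (fun x =>
      dotv (alpha x (pstar x) *m wgrad Om w x) (wgrad Om w x))
  + Rintegral (lebesgue_vec R d) Om (fun x => w x *
      dotv (coeff_s alpha x (pstar x) *m wgrad Om pstar x) (wgrad Om w x)).
  rewrite -RintegralD//; apply: eq_Rintegral => x _.
  by rewrite dotvDl dotvZl.
(* the Poincare inequality on the kernel, multiplied by Cp |w|_1 *)
have := norm0_interp_ker hOmo hT hIH (ltW hC) kw.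
move=> /(ler_wpM2r (norm0_ge0 Om (fun x => enorm (wgrad Om w x)))).
move=> /(ler_wpM2l Cp0) wle.
move: leB; rewrite ler_norml => /andP[leB _].
apply: le_trans (lerD leA leB).
apply: le_trans (lerB (lexx _) wle).
rewrite -/C_I /semi1 le_eqVlt; apply/orP; left; apply/eqP.
by field; rewrite gt_eqF.
Qed.
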